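(* Let $\mathcal{E}:=(K(b^\prime)|K,v)$ be a finite defectless Galois extension of henselian non-trivially valued fields. Assume that $b^\prime$ is pure over $K$. Then there exists a generator $b$ of $K(b^\prime)|K$ with $b$ pure over $K$ such that for any non-trivial subgroup $H$ of $\mathcal{G}:=\mathrm{Gal}(K(b^\prime)|K)$, $$\mathcal{I}_H=\left(\frac{\sigma b}{b}-1\ \Big|\ \sigma\in H\right),$$ where the right-hand side is the ideal of $\mathcal O_{K(b')}$ generated by the indicated elements.
   Context: $\overline{K}$ is a fixed algebraic closure of $K$; the unique extension of $v$ to $\overline K$ is again denoted $v$. $vF$ and $Fv$ denote value group and residue field, $\mathcal O_F$ the valuation ring; $\deg_K(b)=[K(b):K]$. A finite extension $(E|K,v)$ is defectless if $[E:K]=(vE:vK)[Ev:Kv]$. A generator of $\Omega|K$ is an element $b$ with $\Omega=K(b)$. For a subgroup $H$ of $\mathcal G$, $\mathcal I_H$ is the ideal of $\mathcal O_{K(b')}$ generated by all $\frac{\sigma z}{z}-1$ with $\sigma\in H$, $z\in K(b')^\times$. Purity: for $a\in\overline K\setminus K$ and a positive integer $d<\deg_K(a)$ put $D_d:=\{v(z-a)\mid z\in\overline K,\ \deg_K(z)=d\}$. An Okutsu sequence of $a$ over $K$ is a finite sequence $A_0=\{a\},A_1,\dots,A_n$ of subsets of $\overline K$, all elements of $A_i$ having the same degree $d_i$ over $K$, such that: (OS1) $\deg_K(a)=d_0>d_1>\dots>d_n=1$; (OS2) for all $i\geq1$ and $z\in\overline K$ with $\deg_K(z)<d_{i-1}$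 there is $z_i\in A_i$ with $v(a-z_i)\geq v(a-z)$; (OS3) $v(a-z_{i-1})>v(a-z_i)$ for all $i\ge 1$, $z_i\in A_i$, $z_{i-1}\in A_{i-1}$; (OS4) for $i\geq 1$, $\#A_i=1$ if and only if $\max D_{d_i}$ exists, and then $A_i=\{a_i\}$ with $v(a-a_i)=\max D_{d_i}=\max\{v(a-z)\mid \deg_K(z)<d_{i-1}\}$; (OS5) if $\max D_{d_i}$ does not exist, then $A_i=\{z_\nu\}_{\nu<\lambda}$ with $\lambda$ a limit ordinal and $v(a-z_\mu)>v(a-z_\nu)$ for all $\nu<\mu<\lambda$. Every $a\in\overline K\setminus K$ admits an Okutsu sequence, and all its Okutsu sequences have the same length $n=:\ell_K(a)$. The element $a$ is pure over $K$ if $\ell_K(a)=1$. *)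

(* Defs.v *)
From HB Require Import structures.
From mathcomp Require Import all_boot all_order all_algebra all_fingroup all_field.
From mathcomp Require Import boolp classical_sets functions cardinality wochoice.

Set Implicit Arguments.
Unset Strict Implicit.
Unset Printing Implicit Defensive.

Import Order.TTheory GRing.Theory Num.Theory.

Local Open Scope classical_set_scope.
Local Open Scope quotient_scope.
Local Open Scope ring_scope.

(* Totality is part of the mixin, as the join of [Order.Total] and
   [GRing.Zmodule] cannot be declared on top of the ssrnum hierarchy. *)
HB.mixin Record isOrderedAbelianGroup G & Num.POrderedZmodule G := {
  oag_le_total : forall x y : G, (x <= y) || (y <= x);
  oag_leD2l : forall z x y : G, x <= y -> z + x <= z + y
}.

#[short(type="oagType")]
HB.structure Definition OrderedAbelianGroup :=
  { G of Num.POrderedZmodule G & isOrderedAbelianGroup G }.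

Section ExtendedValues.
Variable G : oagType.

(* [option G] is G together with the value infinity, represented by [None]. *)
Definition vadd (x y : option G) : option G :=
  match x, y with Some a, Some b => Some (a + b) | _, _ => None end.

Definition vle (x y : option G) : bool :=
  match x, y with
  | _, None => true
  | None, Some _ => false
  | Some a, Some b => a <= b
  end.

Definition vlt (x y : option G) : bool := ~~ vle y x.

Definition is_vmax (D : set (option G)) (m : option G) : Prop :=
  D m /\ forall x, D x -> vle x m.

Lemma vle_refl x : vle x x.
Proof. by case: x => //= a; exact: lexx. Qed.

Lemma vle_trans y x z : vle x y -> vle y z -> vle x z.
Proof. by case: x y z => [a|] [b|] [c|] //=; exact: le_trans. Qed.

Lemma vle_total x y : vle x y || vle y x.
Proof. by case: x y => [a|] [b|] //=; exact: oag_le_total. Qed.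

Lemma vltW x y : vlt x y -> vle x y.
Proof. by rewrite /vlt => /negbTE h; move: (vle_total x y); rewrite h orbF. Qed.

Lemma vlt_le_trans y x z : vlt x y -> vle y z -> vlt x z.
Proof. by rewrite /vlt => h yz; apply: contra h; exact: vle_trans. Qed.

Lemma oag_leD (a b c d : G) : a <= b -> c <= d -> a + c <= b + d.
Proof.
move=> ab cd; apply: (le_trans (oag_leD2l a _ _ cd)).
by rewrite ![_ + d]addrC; exact: oag_leD2l.
Qed.

End ExtendedValues.

(* [vfunD] is v (x + y) >= min (v x) (v y). The codomain G may be larger than
   the value group vF. *)
Record valuation (F : fieldType) (G : oagType) := Valuation {
  vfun :> F -> option G;
  vfun_infty : forall x, vfun x = None <-> x = 0;
  vfunM : forall x y, vfun (x * y) = vadd (vfun x) (vfun y);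
  vfunD : forall x y, vle (vfun x) (vfun (x + y)) || vle (vfun y) (vfun (x + y))
}.

Section ResidueField.
Variables (F : fieldType) (G : oagType) (v : valuation F G).

Lemma vfun0 : v 0 = None. Proof. exact/vfun_infty. Qed.

Lemma vfun_fin x : x != 0 -> exists g, v x = Some g.
Proof.
move=> /eqP x0; case E : (v x) => [g|]; first by exists g.
by case: x0; apply/(vfun_infty v).
Qed.

Lemma vfun1 : v 1 = Some 0.
Proof.
have [g vg] := vfun_fin (oner_neq0 F).
have := vfunM v 1 1; rewrite mulr1 vg /= => -[] h.
by congr Some; apply: (addrI g); rewrite addr0 -h.
Qed.

Lemma oag_double0 (g : G) : g + g = 0 -> g = 0.
Proof.
move=> gg; apply/eqP; rewrite eq_le; apply/andP; split.
- case/orP: (oag_le_total g 0) => // g0.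
  by rewrite -gg -[X in X <= _]addr0; apply: oag_leD2l.
- case/orP: (oag_le_total 0 g) => // g0.
  by rewrite -gg -[X in _ <= X]addr0; apply: oag_leD2l.
Qed.

Lemma vfunN x : v (- x) = v x.
Proof.
have vN1 : v (-1) = Some 0.
  have [g vg] : exists g, v (-1) = Some g by apply: vfun_fin; rewrite oppr_eq0 oner_neq0.
  have := vfunM v (-1) (-1); rewrite mulrNN mulr1 vfun1 vg /= => -[] h.
  by rewrite (oag_double0 (esym h)).
by rewrite -mulN1r vfunM vN1; case: (v x) => //= a; rewrite add0r.
Qed.

Definition vring_pred : {pred F} := fun x => vle (Some 0) (v x).

Lemma vring_subring_closed : subring_closed vring_pred.
Proof.
split=> [|x y|x y]; rewrite /vring_pred !unfold_in.
- by rewrite vfun1 vle_refl.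
- move=> hx hy; case/orP: (vfunD v x (- y)) => h; apply: vle_trans h => //.
  by rewrite vfunN.
- rewrite vfunM; case: (v x) (v y) => [a|] [b|] //= a0 b0.
  by rewrite -[0]addr0; exact: oag_leD.
Qed.

HB.instance Definition _ :=
  GRing.isSubringClosed.Build F vring_pred vring_subring_closed.

Record vring := VRing { vring_val :> F; _ : vring_val \in vring_pred }.

HB.instance Definition _ := [isSub for vring_val].
HB.instance Definition _ := [Choice of vring by <:].
HB.instance Definition _ := [SubChoice_isSubComNzRing of vring by <:].

Definition vmaxideal : {pred vring} := fun x => vlt (Some 0) (v (\val x)).

Lemma vmaxideal_idealr_closed : idealr_closed vmaxideal.
Proof.
split=> [||a x y]; rewrite /vmaxideal !unfold_in.
- by rewrite rmorph0 vfun0.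
- by rewrite rmorph1 vfun1 /vlt vle_refl.
- move=> hx hy; rewrite rmorphD rmorphM.
  case/orP: (vfunD v (\val a * \val x) (\val y)) => h; last exact: vlt_le_trans h.
  apply: vlt_le_trans h; rewrite vfunM; apply: vlt_le_trans hx _.
  have : vle (Some 0) (v (\val a)) by exact: (valP a).
  case: (v (\val a)) (v (\val x)) => [b|] [c|] //= b0.
  by rewrite -[X in X <= _]add0r; apply: oag_leD.
Qed.

HB.instance Definition _ :=
  isIdealr.Build vring vmaxideal vmaxideal_idealr_closed.

Definition residue_field := {ideal_quot vmaxideal}.

HB.instance Definition _ := GRing.ComNzRing.on residue_field.

Definition residue (x : vring) : residue_field := \pi_{ideal_quot vmaxideal} x.

Lemma residue_is_zmod_morphism : zmod_morphism residue.
Proof. by move=> x y; rewrite /residue rmorphB. Qed.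

Lemma residue_is_monoid_morphism : monoid_morphism residue.
Proof. by split=> [|x y]; rewrite /residue (rmorph1, rmorphM). Qed.

HB.instance Definition _ :=
  GRing.isZmodMorphism.Build vring residue_field residue residue_is_zmod_morphism.
HB.instance Definition _ :=
  GRing.isMonoidMorphism.Build vring residue_field residue residue_is_monoid_morphism.

Lemma residue_surj (r : residue_field) : exists x, residue x = r.
Proof. by exists (generic_quotient.repr r); exact: generic_quotient.reprK. Qed.

Lemma residue_eq0 x : (residue x == 0) = vlt (Some 0) (v (\val x)).
Proof.
have := Quotient.idealrBE vmaxideal x 0; rewrite subr0 => e.
by rewrite -(rmorph0 residue) /residue -e.
Qed.

Lemma residue_inv_ex (r : residue_field) :
  exists s, if r == 0 then s == 0 else s * r == 1.
Proof.
case: eqVneq => [_|]; first by exists 0.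
have [x <-] := residue_surj r; rewrite residue_eq0 /vlt negbK => x0.
have vx := valP x; rewrite /vring_pred unfold_in in vx.
have nx : \val x != 0 by apply/eqP => h; rewrite h vfun0 in x0.
have [g vg] := vfun_fin nx.
have g0 : g = 0 by apply/eqP; rewrite eq_le; move: x0 vx; rewrite vg /= => -> ->.
have [h vh] : exists h, v (\val x)^-1 = Some h by apply: vfun_fin; rewrite invr_eq0.
have h0 : h = 0.
  have := vfunM v (\val x)^-1 (\val x).
  by rewrite mulVf // vfun1 vg vh g0 /= addr0 => -[].
have iO : (\val x)^-1 \in vring_pred by rewrite unfold_in /vring_pred vh h0 vle_refl.
exists (residue (VRing iO)); apply/eqP; rewrite -rmorphM -(rmorph1 residue).
by congr residue; apply: val_inj; rewrite rmorphM rmorph1 /= mulVf.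
Qed.

Definition residue_inv (r : residue_field) : residue_field :=
  xchoose (residue_inv_ex r).

Lemma residue_invP r : if r == 0 then residue_inv r == 0 else residue_inv r * r == 1.
Proof. exact: (xchooseP (residue_inv_ex r)). Qed.

Lemma residue_mulVf (r : residue_field) : r != 0 -> residue_inv r * r = 1.
Proof.
by move=> /negbTE r0; have := residue_invP r; rewrite r0 => /eqP.
Qed.

Lemma residue_inv0 : residue_inv 0 = 0.
Proof. by have := residue_invP 0; rewrite eqxx => /eqP. Qed.

HB.instance Definition _ :=
  GRing.ComNzRing_isField.Build residue_field residue_mulVf residue_inv0.

(* vS and Sv as subsets of G and Fv, for a subfield S of F *)
Definition value_group (S : set F) : set G :=
  [set g | exists2 x, S x & v x = Some g].

Definition residue_subfield (S : set F) : set residue_field :=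
  [set residue x | x in [set x : vring | S (\val x)]].

End ResidueField.

Arguments residue_subfield {F G} v S.

(* n = (A : B), for subgroups B of A of an abelian group *)
Definition is_index (G : zmodType) (A B : set G) (n : nat) : Prop :=
  ([set [set g + h | h in B] | g in A] #= `I_n)%card.

(* n = [S : k], for subfields k of S of a field *)
Definition is_degree (F : fieldType) (S k : set F) (n : nat) : Prop :=
  exists e : 'I_n -> F, (forall i, S (e i)) /\
    forall y, S y -> exists! c : {ffun 'I_n -> F},
      (forall i, k (c i)) /\ y = \sum_i c i * e i.

Definition is_subfield (F : fieldType) (S : set F) : Prop :=
  [/\ S 1, forall x y, S x -> S y -> S (x - y)
         & forall x y, S x -> S y -> S (x / y)].

Definition adjoin (F : fieldType) (k : set F) (b : F) : set F :=
  smallest (@is_subfield F) (k `|` [set b]).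

Section ValuedField.
Variables (K : fieldType) (Kbar : closedFieldType) (iota : {rmorphism K -> Kbar}).
Variables (G : oagType) (v : valuation Kbar G).

(* v is, up to equivalence, the only extension to Kbar of its restriction to K;
   two valuations are equivalent if they have the same valuation ring. *)
Definition henselian : Prop :=
  forall (G' : oagType) (w : valuation Kbar G'),
    (forall x : K, vle (Some 0) (w (iota x)) = vle (Some 0) (v (iota x))) ->
    forall x : Kbar, vle (Some 0) (w x) = vle (Some 0) (v x).

Definition nontrivially_valued : Prop :=
  exists2 x : K, x != 0 & v (iota x) != Some 0.

Definition defectless (E : fieldExtType K) (j : {rmorphism E -> Kbar}) : Prop :=
  exists e f : nat,
    [/\ is_index (value_group v (range j)) (value_group v (range iota)) e,
        is_degree (residue_subfield v (range j)) (residue_subfield v (range iota)) f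
      & \dim {:E} = (e * f)%N].

(* n = deg_K(z) = [K(z) : K] *)
Definition has_deg (z : Kbar) (n : nat) : Prop :=
  is_degree (adjoin (range iota) z) (range iota) n.

Definition dist_deg_eq (a : Kbar) (d : nat) : set (option G) :=
  [set v (z - a) | z in [set z | has_deg z d]].

Definition dist_deg_lt (a : Kbar) (d : nat) : set (option G) :=
  [set v (a - z) | z in [set z | exists2 m, has_deg z m & (m < d)%N]].

(* A = {z_nu | nu < lambda} for a limit ordinal lambda (here: a nonempty
   well-ordered type without last element), with v (a - z_nu) increasing. *)
Definition okutsu_limit (a : Kbar) (A : set Kbar) : Prop :=
  exists (disp : Order.disp_t) (I : orderType disp) (z : I -> Kbar),
    [/\ well_order (<=%O : rel I),
        inhabited I /\ (forall nu : I, exists mu : I, (nu < mu)%O),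
        A = range z
      & forall nu mu : I, (nu < mu)%O -> vlt (v (a - z nu)) (v (a - z mu))].

(* [d i] is the common degree of the elements of [A i]; only the indices i <= n
   matter, and the index i of (OS2), (OS4), (OS5) is written i.+1 here. *)
Record okutsu_sequence (a : Kbar) (n : nat) (A : nat -> set Kbar) (d : nat -> nat)
    : Prop := OkutsuSequence {
  okutsu_notin : ~ range iota a;
  okutsu_0 : A 0%N = [set a];
  okutsu_deg : forall i z, (i <= n)%N -> A i z -> has_deg z (d i);
  okutsu_OS1 : [/\ has_deg a (d 0%N), forall i, (i < n)%N -> (d i.+1 < d i)%N
                 & d n = 1%N];
  okutsu_OS2 : forall i z m, (i < n)%N -> has_deg z m -> (m < d i)%N ->
    exists2 z', A i.+1 z' & vle (v (a - z)) (v (a - z'));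
  okutsu_OS3 : forall i z z', (i < n)%N -> A i z -> A i.+1 z' ->
    vlt (v (a - z')) (v (a - z));
  okutsu_OS4 : forall i, (i < n)%N ->
    ((exists z, A i.+1 = [set z]) <-> (exists m, is_vmax (dist_deg_eq a (d i.+1)) m))
    /\ (forall z, A i.+1 = [set z] ->
          is_vmax (dist_deg_eq a (d i.+1)) (v (a - z)) /\
          is_vmax (dist_deg_lt a (d i)) (v (a - z)));
  okutsu_OS5 : forall i, (i < n)%N ->
    ~ (exists m, is_vmax (dist_deg_eq a (d i.+1)) m) -> okutsu_limit a (A i.+1)
}.

Definition okutsu_length (a : Kbar) (n : nat) : Prop :=
  exists A d, okutsu_sequence a n A d.

Definition pure (a : Kbar) : Prop := okutsu_length a 1.

End ValuedField.

Definition is_ideal (F : fieldType) (O I : set F) : Prop :=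
  [/\ I `<=` O, I 0, forall x y, I x -> I y -> I (x + y)
    & forall c x, O c -> I x -> I (c * x)].

Definition ideal_gen (F : fieldType) (O S : set F) : set F :=
  smallest (is_ideal O) S.

Section RamificationIdeals.
Variables (K : fieldType) (Kbar : closedFieldType) (G : oagType).
Variables (v : valuation Kbar G) (E : splittingFieldType K).
Variable (j : {rmorphism E -> Kbar}).

Definition Oring : set E := [set x | vle (Some 0) (v (j x))].

Definition ramification_ideal (H : {set gal_of {:E}}) : set E :=
  ideal_gen Oring
    [set y | exists2 sigma : gal_of {:E}, sigma \in H &
             exists2 z : E, z != 0 & y = sigma z / z - 1].

Definition ideal_of_generator (b : E) (H : {set gal_of {:E}}) : set E :=
  ideal_gen Oring
    [set y | exists2 sigma : gal_of {:E}, sigma \in H & y = sigma b / b - 1].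

End RamificationIdeals.

(* Main.v *)
(** Since [K(b')|K] is defectless, it has a valuation basis, so [v (b' - c)] attains
    its maximum over [c] in [K]; take [b = b' - c] for such a [c]. By purity of [b'],
    [v (b - t) <= v b] for all [t] of degree less than [n = [K(b) : K]].
    Write [z] in [K(b)^*] as [f(b)] with [deg f < n]; the roots [t] of [f] have degree
    less than [n], and [sigma z / z] is the product of the factors
    [(sigma b - t) / (b - t) = 1 + (sigma b - b) / (b - t)], each of which differs from
    1 by an element of value at least [v (sigma b / b - 1)]. Hence so does [sigma z / z].
    The invariance [v (sigma b) = v b] also follows from the valuation basis. *)

Require Import Defs.
From HB Require Import structures.
From mathcomp Require Import all_boot all_order all_algebra all_fingroup all_field.
From mathcomp Require Import boolp classical_sets functions cardinality.

Set Implicit Arguments.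
Unset Strict Implicit.
Unset Printing Implicit Defensive.

Import Order.TTheory GRing.Theory Num.Theory.

Local Open Scope ring_scope.

(** * Inequalities between values of sums, products and powers *)

Section Valuations.
Variables (F : fieldType) (G : oagType) (v : valuation F G).

Lemma vle_lt_trans (x y z : option G) : vle x y -> vlt y z -> vlt x z.
Proof. by rewrite /vlt => xy; apply: contra => zx; apply: vle_trans zx xy. Qed.

Lemma vle_infty (x : option G) : vle x None.
Proof. by case: x. Qed.

Lemma vle_anti (x y : option G) : vle x y -> vle y x -> x = y.
Proof.
by case: x y => [a|] [b|] //= ab ba; congr Some; apply/le_anti; rewrite ab.
Qed.

Lemma vle_mul (a b c d : F) :
  vle (v a) (v b) -> vle (v c) (v d) -> vle (v (a * c)) (v (b * d)).
Proof.
by rewrite !vfunM; case: (v a) (v b) (v c) (v d) => [?|] [?|] [?|] [?|] //=;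
   apply: oag_leD.
Qed.

Lemma vle_mulr (c a b : F) : c != 0 -> vle (v (a * c)) (v (b * c)) = vle (v a) (v b).
Proof.
move=> c0; apply/idP/idP => h; last exact: vle_mul h (vle_refl _).
by rewrite -(mulfK c0 a) -(mulfK c0 b); apply: vle_mul h (vle_refl _).
Qed.

Lemma vlt_mulr (c a b : F) : c != 0 -> vlt (v (a * c)) (v (b * c)) = vlt (v a) (v b).
Proof. by move=> c0; rewrite /vlt vle_mulr. Qed.

Lemma vle_infty_eq0 (x : F) : vle None (v x) -> x = 0.
Proof. by move=> h; apply/(vfun_infty v); case: (v x) h. Qed.

Lemma vle_add g (x y : F) : vle g (v x) -> vle g (v y) -> vle g (v (x + y)).
Proof.
by move=> gx gy; case/orP: (vfunD v x y); apply: vle_trans.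
Qed.

Lemma vle_sub g (x y : F) : vle g (v x) -> vle g (v y) -> vle g (v (x - y)).
Proof. by move=> gx gy; apply: vle_add => //; rewrite vfunN. Qed.

Lemma vle_sum g (I : Type) (r : seq I) (P : pred I) (f : I -> F) :
  (forall i, P i -> vle g (v (f i))) -> vle g (v (\sum_(i <- r | P i) f i)).
Proof.
move=> h; elim/big_rec: _ => [|i x Pi]; first by rewrite vfun0 vle_infty.
exact: vle_add (h _ Pi).
Qed.

Lemma vlt_add g (x y : F) : vlt g (v x) -> vlt g (v y) -> vlt g (v (x + y)).
Proof.
by move=> gx gy; case/orP: (vfunD v x y); apply: vlt_le_trans.
Qed.

(** The bound is finite here because the empty sum has value infinity, which is not strictly above
    infinity. *)
Lemma vlt_sum g (I : Type) (r : seq I) (P : pred I) (f : I -> F) :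
  (forall i, P i -> vlt (Some g) (v (f i))) -> vlt (Some g) (v (\sum_(i <- r | P i) f i)).
Proof.
move=> h; elim/big_rec: _ => [|i x Pi]; first by rewrite vfun0.
exact: vlt_add (h _ Pi).
Qed.

Lemma vle_prod (I : Type) (r : seq I) (P : pred I) (f g : I -> F) :
  (forall i, P i -> vle (v (f i)) (v (g i))) ->
  vle (v (\prod_(i <- r | P i) f i)) (v (\prod_(i <- r | P i) g i)).
Proof.
move=> h; elim/big_rec2: _ => [|i x y Pi]; first by rewrite vle_refl.
exact: vle_mul (h _ Pi).
Qed.

Lemma vle_exp0 (x : F) n : (0 < n)%N -> vle (Some 0) (v (x ^+ n)) -> vle (Some 0) (v x).
Proof.
move=> n0 h; apply/negPn/negP => x0.
case: n n0 h => // n _; apply/negP; rewrite -/(vlt _ _).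
elim: n => [|n IH]; first by rewrite expr1.
rewrite exprS; apply: vle_lt_trans IH.
rewrite -[X in vle _ (v X)]mul1r; apply: vle_mul (vle_refl _).
by rewrite vfun1; apply: vltW.
Qed.

Lemma vfun_min (I : finType) (i0 : I) (f : I -> F) :
  exists i, forall k, vle (v (f i)) (v (f k)).
Proof.
suff [i _ h] : exists2 i, true & forall k, k \in enum I -> vle (v (f i)) (v (f k)).
  by exists i => k; apply: h; rewrite mem_enum.
elim: (enum I) => [|a s [i _ IH]]; first by exists i0.
case/orP: (vle_total (v (f a)) (v (f i))) => ai.
  exists a => // k; rewrite inE => /orP[/eqP->|/IH]; first exact: vle_refl.
  exact: vle_trans.
by exists i => // k; rewrite inE => /orP[/eqP->|/IH].
Qed.

(* Each linear factor [(a' - z) / (a - z) = 1 + (a' - a) / (a - z)]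
   is at least as close to 1 as [a' / a]. *)
Lemma vle_prod_sub1 (a a' : F) (r : seq F) :
  a != 0 -> vle (Some 0) (v (a' / a - 1)) ->
  (forall z, z \in r -> vle (v (a - z)) (v a)) ->
  (forall z, z \in r -> a != z) ->
  vle (v (a' / a - 1)) (v (\prod_(z <- r) ((a' - z) / (a - z)) - 1)).
Proof.
move=> a0 ge0; elim: r => [|z r IH] hv hn.
  by rewrite big_nil subrr vfun0 vle_infty.
rewrite big_cons.
have az : a - z != 0 by rewrite subr_eq0 hn ?mem_head.
have {}IH : vle (v (a' / a - 1)) (v (\prod_(z <- r) ((a' - z) / (a - z)) - 1)).
  by apply: IH => w wr; [apply: hv|apply: hn]; rewrite inE wr orbT.
have hz : vle (v (a' / a - 1)) (v ((a' - z) / (a - z) - 1)).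
  have -> : (a' - z) / (a - z) - 1 = (a' - a) / (a - z).
    by rewrite -(divff az) -mulrBl opprB addrA subrK.
  rewrite -(divff a0) -mulrBl -(vle_mulr _ _ a0) -(vle_mulr _ _ az) !divfK // mulrAC divfK //.
  by apply: vle_mul (vle_refl _) _; apply: hv; rewrite mem_head.
set x := (a' - z) / _ in hz *; set y := \prod_(_ <- _) _ in IH *.
have -> : x * y - 1 = (x - 1) * (y - 1) + ((x - 1) + (y - 1)).
  by rewrite mulrBl mul1r addrCA subrK mulrBr mulr1 addrC addrA subrK.
(* Since [x - 1] has value at least 0, the product [(x - 1) * (y - 1)] has at least the value of
   [y - 1]. *)
apply: vle_add; last exact: vle_add.
rewrite -[X in vle (v X)]mul1r; apply: vle_mul => //; rewrite vfun1.
exact: vle_trans hz.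
Qed.

End Valuations.

(** * Closure properties of subfields given as sets *)

Section Subfields.
Variables (F : fieldType) (S : set F).
Hypothesis subS : is_subfield S.

Lemma is_subfield0 : S 0.
Proof. by case: subS => S1 SB _; rewrite -(subrr 1); apply: SB. Qed.

Lemma is_subfieldN x : S x -> S (- x).
Proof. by case: subS => _ SB _ Sx; rewrite -sub0r; apply: SB => //; apply: is_subfield0. Qed.

Lemma is_subfieldD x y : S x -> S y -> S (x + y).
Proof.
by case: subS => _ SB _ Sx Sy; rewrite -(opprK y); apply: SB => //; apply: is_subfieldN.
Qed.

Lemma is_subfieldM x y : S x -> S y -> S (x * y).
Proof.
case: subS => S1 _ SV Sx Sy; rewrite -(invrK y); apply: (SV) => //.
by rewrite -div1r; apply: SV.
Qed.

Lemma is_subfield_horner (p : {poly F}) x :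
  (forall i, S p`_i) -> S x -> S p.[x].
Proof.
move=> Sp Sx; elim/poly_ind: p Sp => [|p c IH] Sp.
  by rewrite horner0; apply: is_subfield0.
rewrite hornerMXaddC; apply: is_subfieldD; last first.
  by have := Sp 0%N; rewrite coefD coefMX coefC /= add0r.
apply: is_subfieldM => //; apply: IH => i.
by have := Sp i.+1; rewrite coefD coefMX coefC /= addr0.
Qed.

End Subfields.

Lemma is_subfield_smallest (F : fieldType) (A : set F) :
  is_subfield (smallest (@is_subfield F) A).
Proof.
split=> [B [[]]|x y Sx Sy B BP|x y Sx Sy B BP] //; case: (BP) => -[_ SB SV] _.
- exact: SB (Sx _ BP) (Sy _ BP).
- exact: SV (Sx _ BP) (Sy _ BP).
Qed.

(** * Simple algebraic extensions and degrees of elements *)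

Section Degrees.
Variables (K : fieldType) (L : closedFieldType) (iota : {rmorphism K -> L}).
Implicit Types (z : L) (p q : {poly K}).

Definition poly_values z : set L := [set (map_poly iota q).[z] | q in setT].

Lemma is_subfield_adjoin z : is_subfield (adjoin (range iota) z).
Proof. exact: is_subfield_smallest. Qed.

Lemma adjoin_gen z : adjoin (range iota) z z.
Proof. by apply: sub_gen_smallest; right. Qed.

Lemma adjoin_scalar z c : adjoin (range iota) z (iota c).
Proof. by apply: sub_gen_smallest; left; exists c. Qed.

Lemma adjoin1 z : adjoin (range iota) z 1.
Proof. by case: (is_subfield_adjoin z). Qed.

Arguments adjoin_gen : clear implicits.
Arguments adjoin_scalar : clear implicits.
Arguments adjoin1 : clear implicits.

Lemma adjoin_poly_value z q : adjoin (range iota) z (map_poly iota q).[z].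
Proof.
apply: (is_subfield_horner (is_subfield_adjoin z)); last exact: adjoin_gen.
by move=> i; rewrite coef_map; apply: adjoin_scalar.
Qed.

(** This is the minimal polynomial of [z] up to a nonzero scalar. *)
Definition min_root z p :=
  [/\ p != 0, root (map_poly iota p) z &
   forall q, root (map_poly iota q) z -> (size q < size p)%N -> q = 0].

Lemma min_root_ex z q : q != 0 -> root (map_poly iota q) z ->
  exists2 p, min_root z p & (size p <= size q)%N.
Proof.
move=> q0 qz.
pose P n := `[< exists p, [/\ p != 0, root (map_poly iota p) z & size p = n] >].
have exP : exists n, P n by exists (size q); apply/asboolP; exists q.
case: (ex_minnP exP) => m /asboolP[p [p0 pz sp]] min.
exists p; last by rewrite sp; apply: min; apply/asboolP; exists q.
split=> // r rz; rewrite sp ltnNge => /negP h; apply/eqP/negPn/negP => r0.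
by apply: h; apply: min; apply/asboolP; exists r.
Qed.

Lemma min_root_mod z p q : min_root z p ->
  (map_poly iota q).[z] = (map_poly iota (q %% p)).[z].
Proof.
case=> _ /rootP pz _; rewrite {1}(divp_eq q p) rmorphD rmorphM /=.
by rewrite hornerD hornerM pz mulr0 add0r.
Qed.

(** If [p] and [q] had a common factor of positive degree, it would not vanish at [z], so its
    cofactor in [p] would be a polynomial of smaller degree with root [z]. Hence they are coprime,
    and a Bezout relation evaluated at [z] gives the inverse. *)
Lemma min_root_unit z p q : min_root z p -> (map_poly iota q).[z] != 0 ->
  exists r, (map_poly iota r).[z] = (map_poly iota q).[z]^-1.
Proof.
case=> p0 pz pmin qz.
have cop : coprimep p q.
  have [h ph] : exists h, p = h * gcdp p q by apply/dvdpP; apply: dvdp_gcdl.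
  have [k qk] : exists k, q = k * gcdp p q by apply/dvdpP; apply: dvdp_gcdr.
  have gz : (map_poly iota (gcdp p q)).[z] != 0.
    by apply: contraNneq qz => gz; rewrite qk rmorphM hornerM /= gz mulr0.
  have h0 : h != 0 by apply: contraNneq p0 => h0; rewrite ph h0 mul0r.
  have g0 : gcdp p q != 0 by rewrite gcdp_eq0 negb_and p0.
  have hz : root (map_poly iota h) z.
    by move: pz; rewrite {1}ph rmorphM rootM /= => /orP[//|]; rewrite /root (negbTE gz).
  rewrite /coprimep; apply/eqP.
  (* The size of a product is the sum of the sizes minus one, so this leaves size 1 as the only
     possibility for the nonzero gcd. *)
  have : ~~ (size h < size p)%N by apply/negP => /(pmin _ hz) /eqP; rewrite (negbTE h0).
  rewrite {1}ph size_mul // -leqNgt.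
  case: (size (gcdp p q)) (size_poly_eq0 (gcdp p q)) => [|[|n]] //=.
    by rewrite eqxx (negbTE g0).
  by rewrite addnS /= addnS ltnNge leq_addr.
have [[u w] /= e] := Bezout_eq1_coprimepP _ _ cop.
exists w; rewrite -[RHS]div1r; apply: (canRL (mulfK qz)); rewrite -hornerM -rmorphM /=.
have -> : w * q = 1 - u * p by rewrite -e addrAC subrr add0r.
rewrite rmorphB rmorph1 rmorphM hornerD hornerN hornerM /= (rootP pz) mulr0 subr0.
by rewrite hornerC.
Qed.

(** The polynomial values at [z] contain [K] and [z], and by [min_root_unit] they form a
    subfield. *)
Lemma adjoin_algebraic z p y : min_root z p -> adjoin (range iota) z y ->
  exists q, y = (map_poly iota q).[z].
Proof.
move=> pz; suff h : (adjoin (range iota) z `<=` poly_values z)%classic.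
  by move=> /h[q _ <-]; exists q.
apply: smallest_sub; last first.
  move=> x [[c _ <-]|->]; first by exists c%:P => //; rewrite map_polyC hornerC.
  by exists 'X => //; rewrite map_polyX hornerX.
clear y; split=> [|x y [q _ <-] [r _ <-]|x y [q _ <-] [r _ <-]].
- by exists 1 => //; rewrite rmorph1 hornerC.
- by exists (q - r) => //; rewrite rmorphB hornerD hornerN.
- have [->|r0] := eqVneq (map_poly iota r).[z] 0.
    by exists 0 => //; rewrite invr0 mulr0 rmorph0 horner0.
  have [s <-] := min_root_unit pz r0.
  by exists (q * s) => //; rewrite rmorphM hornerM.
Qed.

(** The powers of [z] below the degree of its minimal polynomial [p] form a basis: division by [p]
    yields coordinates, and two different families of coordinates would give a nonzero polynomial of
    degree below that of [p] vanishing at [z]. *)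
Lemma has_deg_root z q : q != 0 -> root (map_poly iota q) z ->
  exists2 m, has_deg iota z m & (m < size q)%N.
Proof.
move=> q0 /(min_root_ex q0)[p pz pq]; case: (pz) => p0 _ pmin.
have sp : (size p).-1.+1 = size p by rewrite prednK // size_poly_gt0.
exists (size p).-1; last by rewrite sp.
have horn (d : 'I_(size p).-1 -> K) :
    \sum_i iota (d i) * z ^+ i = (map_poly iota (\sum_i d i *: 'X^i)).[z].
  rewrite rmorph_sum horner_sum; apply: eq_bigr => i _.
  by rewrite /= map_polyZ hornerZ map_polyXn hornerXn.
exists (fun i => z ^+ i); split=> [i|y /(adjoin_algebraic pz)[r ->]].
  by have := @adjoin_poly_value z ('X^i); rewrite map_polyXn hornerXn.
rewrite (min_root_mod _ pz); set s := r %% p.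
have ss : (size s <= (size p).-1)%N by rewrite -ltnS sp ltn_modp.
exists [ffun i : 'I_(size p).-1 => iota s`_i]; split.
  split=> [i|]; first by rewrite ffunE; exists s`_i.
  under eq_bigr => i _ do rewrite ffunE.
  rewrite horn; congr (_ .[_]); congr map_poly.
  rewrite -poly_def; apply/polyP => k; rewrite coef_poly.
  by case: ltnP => // /(leq_trans ss) sk; rewrite nth_default.
move=> c [kc e]; apply/ffunP => i; rewrite ffunE.
have /choice[d dc] k : exists x, c k = iota x by case: (kc k) => x _ <-; exists x.
pose t := \sum_i d i *: 'X^i : {poly K}.
have tE k : t`_(k : 'I__) = d k.
  rewrite coef_sum (bigD1 k) //= coefZ coefXn eqxx mulr1 big1 ?addr0 // => l lk.
  by rewrite coefZ coefXn eq_sym (negbTE lk : (l == k :> nat) = false) mulr0.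
suff /eqP : s - t = 0 by rewrite subr_eq0 dc => /eqP ->; rewrite tE.
apply: pmin.
  rewrite /root rmorphB hornerD hornerN e subr_eq0 /t -horn; apply/eqP.
  by apply: eq_bigr => k _; rewrite dc.
rewrite -sp ltnS (leq_trans (size_polyD _ _)) // geq_max ss size_polyN.
apply: (leq_trans (size_sum _ _ _)); apply/bigmax_leqP => k _.
by rewrite (leq_trans (size_scale_leq _ _)) // size_polyXn.
Qed.

Lemma has_deg_gt0 z m : has_deg iota z m -> (0 < m)%N.
Proof.
case: m => // -[e [_ /(_ 1 (adjoin1 z))]].
by move=> [c [[_ /eqP]]]; rewrite big_ord0 oner_eq0.
Qed.

Lemma range_has_deg1 z : range iota z -> has_deg iota z 1.
Proof.
case=> c _ <-.
have [||m h] := @has_deg_root (iota c) ('X - c%:P).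
- by rewrite polyXsubC_eq0.
- by rewrite rmorphB /= map_polyX map_polyC root_XsubC.
rewrite size_XsubC ltnS => m1.
suff /eqP <- : m == 1%N by [].
by rewrite eqn_leq m1 (has_deg_gt0 h).
Qed.

(** With a single basis element [e], write [1 = x e] and [z = y e]; then [z = y / x]. *)
Lemma has_deg1_range z : has_deg iota z 1 -> range iota z.
Proof.
case=> e [_ h].
have [c [[/(_ ord0)[x _ cx]]]] := h 1 (adjoin1 z).
rewrite big_ord1 -cx => e1 _.
have [d [[/(_ ord0)[y _ dy]]]] := h z (adjoin_gen z).
rewrite big_ord1 -dy => -> _.
exists (y / x) => //; rewrite fmorph_div.
have x0 : iota x != 0 by apply/eqP => x0; move/eqP: e1; rewrite x0 mul0r oner_eq0.
by apply: (mulIf x0); rewrite divfK // -mulrA [e _ * _]mulrC -e1 mulr1.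
Qed.

Lemma adjoinD_sub z c :
  (adjoin (range iota) (z + iota c) `<=` adjoin (range iota) z)%classic.
Proof.
apply: smallest_sub; first exact: is_subfield_adjoin.
move=> x [[d _ <-]|->]; first exact: adjoin_scalar.
exact: (is_subfieldD (is_subfield_adjoin z)) (adjoin_gen z) (adjoin_scalar z c).
Qed.

Lemma has_degD z c m : has_deg iota (z + iota c) m <-> has_deg iota z m.
Proof.
rewrite /has_deg.
suff -> : adjoin (range iota) (z + iota c) = adjoin (range iota) z by [].
apply/seteqP; split; first exact: adjoinD_sub.
by have := @adjoinD_sub (z + iota c) (- c); rewrite rmorphN addrK.
Qed.

End Degrees.

(** * Valuation bases of defectless extensions *)

Section ValuationBasis.
Variables (K : fieldType) (Kbar : closedFieldType) (iota : {rmorphism K -> Kbar}).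
Variables (G : oagType) (v : valuation Kbar G).
Variables (E : fieldExtType K) (j : {rmorphism E -> Kbar}).
Hypothesis jK : forall c : K, j c%:A = iota c.

Lemma rmorph_scale c x : j (c *: x) = iota c * j x.
Proof. by rewrite -mulr_algl rmorphM jK. Qed.

(** The value of a sum is always at least the minimum of the values of its terms, so this inequality
    makes it equal to that minimum. *)
Definition valuation_independent (I : finType) (B : I -> E) : Prop :=
  forall (c : I -> K) i, vle (v (j (\sum_k c k *: B k))) (v (j (c i *: B i))).

Lemma value_groupD (c d x : K) (a b h : G) :
  v (iota c) = Some a -> v (iota d) = Some b -> v (iota x) = Some h ->
  value_group v (range iota) (a - b + h).
Proof.
move=> ca db xh; exists (iota (c / d * x)); first by exists (c / d * x).
have d0 : iota d != 0 by apply/eqP => d0; move: db; rewrite d0 vfun0.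
have [e de] : exists e, v (iota d)^-1 = Some e by apply: vfun_fin; rewrite invr_eq0.
have := vfunM v (iota d)^-1 (iota d); rewrite mulVf // vfun1 de db => -[] eb.
rewrite rmorphM fmorph_div !vfunM ca de xh /=.
by rewrite (_ : e = - b) //; apply/eqP; rewrite -subr_eq0 opprK -eb.
Qed.

(** The values of the [y i] represent the cosets of [vK] in [vE]. If multiples by elements of [K]
    share a finite value, then the two cosets coincide; [c != 0] rules out the common value
    infinity. *)
Lemma index_representatives e :
  is_index (value_group v (range j)) (value_group v (range iota)) e ->
  exists y : 'I_e -> E, (forall i, y i != 0) /\
    forall i k c d, c != 0 -> v (iota c * j (y i)) = v (iota d * j (y k)) -> i = k.
Proof.
rewrite /is_index card_eq_sym => /card_set_bijP[f [fsub finj _]].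
have /choice[g gP] (i : 'I_e) : exists g,
    value_group v (range j) g /\ [set g + h | h in value_group v (range iota)]%classic = f i.
  by have [g Ag fg] := fsub i (ltn_ord i); exists g.
have /choice[y yP] i : exists y, v (j y) = Some (g i).
  by case: (gP i) => -[_ [y _ <-] yg] _; exists y.
exists y; split=> [i|i k c d c0].
  by apply/eqP => y0; have := yP i; rewrite y0 rmorph0 vfun0.
have [a ca] : exists a, v (iota c) = Some a by apply: vfun_fin; rewrite fmorph_eq0.
rewrite !vfunM !yP ca; case db : (v (iota d)) => [b|] //= [ab].
apply/val_inj/finj; rewrite ?inE //=; try exact: ltn_ord.
rewrite -(gP i).2 -(gP k).2; apply/seteqP; split=> _ [h [_ [x _ <-] xh] <-].
  exists (b - a + h); first exact: value_groupD db ca xh.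
  by rewrite addrA; congr (_ + h); rewrite addrCA addrA -ab addrAC subrr add0r.
exists (a - b + h); first exact: value_groupD ca db xh.
by rewrite addrA; congr (_ + h); rewrite addrCA addrA ab addrAC subrr add0r.
Qed.

(** The [u k] lift a basis of the residue field extension. A combination with integral coefficients
    and positive value reduces to a linear relation, so all its coefficients reduce to zero. *)
Lemma residue_representatives f :
  is_degree (residue_subfield v (range j)) (residue_subfield v (range iota)) f ->
  exists u : 'I_f -> E, (forall k, v (j (u k)) = Some 0) /\
    forall c : 'I_f -> K, (forall k, vle (Some 0) (v (iota (c k)))) ->
      vlt (Some 0) (v (\sum_k iota (c k) * j (u k))) ->
      forall k, vlt (Some 0) (v (iota (c k))).
Proof.
case=> e [eS basis].
have res c (h : iota c \in vring_pred v) :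
    residue_subfield v (range iota) (residue (VRing h)).
  by exists (VRing h) => //; exists c.
have res0 : residue_subfield v (range iota) 0.
  by rewrite -(rmorph0 (@residue _ _ v)); exists 0 => //; exists 0; rewrite ?rmorph0.
have res1 : residue_subfield v (range iota) 1.
  by rewrite -(rmorph1 (@residue _ _ v)); exists 1 => //; exists 1; rewrite ?rmorph1.
(* Linear independence comes from the uniqueness of the coordinates of 0. *)
have free (c : {ffun 'I_f -> residue_field v}) :
    (forall k, residue_subfield v (range iota) (c k)) -> \sum_k c k * e k = 0 ->
    forall k, c k = 0.
  have resj0 : residue_subfield v (range j) 0.
    by rewrite -(rmorph0 (@residue _ _ v)); exists 0 => //; exists 0; rewrite ?rmorph0.
  move=> ck c0; have [d [_ dU]] := basis 0 resj0.
  have dc : d = c by apply: dU; split=> //; rewrite c0.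
  have d0 : d = [ffun => 0].
    apply: dU; split=> [k|]; rewrite ?ffunE //.
    by rewrite big1 // => k _; rewrite ffunE mul0r.
  by move=> k; rewrite -dc d0 ffunE.
have /choice[x xP] k : exists x : vring v, range j (\val x) /\ residue x = e k.
  by case: (eS k) => x; exists x.
have /choice[u uP] k : exists u, j u = \val (x k) by case: (xP k) => -[u]; exists u.
exists u; split=> [k|c c0 sum_gt0 k].
  rewrite uP; apply: vle_anti; last exact: (valP (x k)).
  apply/negPn/negP => xk; have /eqP : residue (x k) = 0.
    by apply/eqP; rewrite residue_eq0.
  rewrite (xP k).2 => /eqP ek0.
  (* If [u k] had positive value, [e k] would vanish and the indicator of [k] would be a nontrivial
     relation. *)
  have : [ffun l => (l == k)%:R : residue_field v] k = 0.
    apply: free => [l|]; first by rewrite ffunE; case: eqP => _.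
    rewrite (bigD1 k) //= ek0 mulr0 add0r big1 // => l /negbTE lk.
    by rewrite ffunE lk mul0r.
  by move/eqP; rewrite ffunE eqxx oner_eq0.
have cO l : iota (c l) \in vring_pred v by exact: c0.
have := free [ffun l => residue (VRing (cO l))] _ _ k; rewrite ffunE => h.
rewrite -[iota (c k)]/(\val (VRing (cO k))) -residue_eq0; apply/eqP/h => [l|].
  by rewrite ffunE; apply: res.
under eq_bigr => l _ do rewrite ffunE -(xP l).2 -rmorphM.
rewrite -rmorph_sum; apply/eqP; rewrite residue_eq0 rmorph_sum.
by under eq_bigr => l _ do rewrite rmorphM /= -uP.
Qed.

(** Let [w q0] have the least value, [q0 = (i0, k0)], and suppose that the whole sum has larger
    value. Rows other than [i0] lie in other cosets of [vK], so their terms have values strictly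
    above the minimum. Hence so does the sum of row [i0]. Dividing by [w q0] gives a combination of
    the [u k] with integral coefficients and positive value, although its coefficient at [k0] is
    1. *)
Lemma valuation_independentM e f (y : 'I_e -> E) (u : 'I_f -> E) :
  (forall i, y i != 0) ->
  (forall i k c d, c != 0 -> v (iota c * j (y i)) = v (iota d * j (y k)) -> i = k) ->
  (forall k, v (j (u k)) = Some 0) ->
  (forall c : 'I_f -> K, (forall k, vle (Some 0) (v (iota (c k)))) ->
      vlt (Some 0) (v (\sum_k iota (c k) * j (u k))) ->
      forall k, vlt (Some 0) (v (iota (c k)))) ->
  valuation_independent (fun p : 'I_e * 'I_f => y p.1 * u p.2).
Proof.
move=> y0 y_cosets u0 u_indep c p.
pose w p := iota (c p) * j (y p.1).
have wE q : j (c q *: (y q.1 * u q.2)) = w q * j (u q.2).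
  by rewrite rmorph_scale rmorphM mulrA.
have vw q : v (w q * j (u q.2)) = v (w q).
  by rewrite vfunM u0; case: (v (w q)) => //= a; rewrite addr0.
rewrite wE vw; have [q0 q0min] := vfun_min v p w.
apply/negPn/negP => plt.
have {plt} sum_gt : vlt (v (w q0)) (v (\sum_i \sum_k w (i, k) * j (u k))).
  apply: vle_lt_trans (q0min p) _; move: plt; rewrite rmorph_sum.
  by rewrite pair_bigA (eq_bigr (fun p => w (p.1, p.2) * j (u p.2))) // => -[i k] _; apply: wE.
have w0 : w q0 != 0.
  by apply/eqP => w0; move: sum_gt; rewrite w0 vfun0 /vlt vle_infty.
case: q0 => i0 k0 in q0min sum_gt w0.
have c0 : c (i0, k0) != 0.
  by apply: contraNneq w0 => c0; rewrite /w c0 rmorph0 mul0r.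
have gt0 : vlt (Some 0) (v (\sum_k iota (c (i0, k) / c (i0, k0)) * j (u k))).
  rewrite -(vfun1 v) -(vlt_mulr _ _ _ w0) mul1r mulr_suml.
  have -> : \sum_k iota (c (i0, k) / c (i0, k0)) * j (u k) * w (i0, k0) =
      \sum_k w (i0, k) * j (u k).
    by apply: eq_bigr => k _; rewrite fmorph_div /w /= mulrAC mulrA divfK ?fmorph_eq0.
  have [g wg] := vfun_fin v w0.
  move: sum_gt; rewrite (bigD1 i0) //= wg => sum_gt.
  (* Row [i0] is the whole sum minus the other rows, all of value greater than [g]. *)
  rewrite -[X in v X](addrK (\sum_(i < e | i != i0) \sum_k w (i, k) * j (u k))).
  apply: vlt_add => //; rewrite vfunN; apply: vlt_sum => i ii0.
  apply: vlt_sum => k _; rewrite (vw (i, k)) -wg.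
  apply/negP => le; move/eqP: ii0; apply.
  have := vle_anti (q0min (i, k)) le.
  by move/(y_cosets _ _ _ _ c0)/esym.
have ge0 k : vle (Some 0) (v (iota (c (i0, k) / c (i0, k0)))).
  rewrite -(vfun1 v) -(vle_mulr _ _ _ w0) mul1r.
  have -> // : iota (c (i0, k) / c (i0, k0)) * w (i0, k0) = w (i0, k).
  by rewrite fmorph_div /w /= mulrA divfK ?fmorph_eq0.
by have := u_indep _ ge0 gt0 k0; rewrite divff // rmorph1 vfun1 /vlt vle_refl.
Qed.

(** Defectlessness makes the number [e * f] of products [y i * u k] equal to the dimension. Division
    by one of them puts 1 into the family and preserves independence. *)
Lemma defectless_valuation_basis : defectless iota v j ->
  exists B : 'I_(\dim {:E}) -> E,
    [/\ forall i, B i != 0, valuation_independent B & exists i, B i = 1].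
Proof.
case=> e [f [/index_representatives[y [y0 y_cosets]]]].
move=> /residue_representatives[u [u0 u_indep]] dimE.
have indep := valuation_independentM y0 y_cosets u0 u_indep.
set T := ('I_e * 'I_f)%type in indep; set B0 := fun p : T => _ in indep.
have cardT : \dim {:E} = #|{: T}| by rewrite card_prod !card_ord.
pose h (i : 'I_(\dim {:E})) : T := enum_val (cast_ord cardT i).
pose h' (p : T) : 'I_(\dim {:E}) := cast_ord (esym cardT) (enum_rank p).
have hK : cancel h h' by move=> i; rewrite /h /h' enum_valK cast_ordK.
have h'K : cancel h' h by move=> i; rewrite /h /h' cast_ordKV enum_rankK.
have B00 p : B0 p != 0.
  rewrite mulf_neq0 // -(fmorph_eq0 j); apply/eqP => uk.
  by have := u0 p.2; rewrite uk vfun0.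
have i0 : 'I_(\dim {:E}) by exists 0%N; apply: adim_gt0.
exists (fun i => B0 (h i) / B0 (h i0)); split=> [i|c i|].
- by rewrite mulf_neq0 ?invr_eq0.
- under eq_bigr => k _ do rewrite scalerAl.
  rewrite -mulr_suml scalerAl !rmorphM vle_mulr ?fmorph_eq0 ?invr_eq0 //.
  have := indep (c \o h') (h i); rewrite /= hK (reindex h) /=; last first.
    by exists h' => ? _.
  by under eq_bigr => k _ do rewrite hK.
- by exists i0; rewrite divff.
Qed.

End ValuationBasis.

(** * Matrices of endomorphisms and determinants of multiplications *)

Section Endomorphisms.
Variables (K : fieldType) (E : fieldExtType K) (n : nat) (e : n.-tuple E).
Hypothesis e_basis : basis_of fullv e.

(** Images of basis vectors are rows, so composition becomes the matrix product in reverse order. *)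
Definition endo_mx (f : 'End(E)) : 'M[K]_n := \matrix_(i, k) coord e k (f e`_i).

Lemma endo_mxE (f : 'End(E)) (i : 'I_n) : f e`_i = \sum_k endo_mx f i k *: e`_k.
Proof.
rewrite {1}(coord_basis e_basis (memvf (f e`_i))).
by apply: eq_bigr => k _; rewrite mxE.
Qed.

Lemma endo_mx_comp (f g : 'End(E)) : endo_mx (g \o f)%VF = endo_mx f *m endo_mx g.
Proof.
apply/matrixP => i l; rewrite mxE comp_lfunE endo_mxE !linear_sum mxE.
by apply: eq_bigr => k _; rewrite !linearZ [X in _ = _ * X]mxE.
Qed.

Lemma endo_mx1 : endo_mx \1%VF = 1%:M.
Proof.
by apply/matrixP => i k; rewrite !mxE id_lfunE coord_free ?(basis_free e_basis).
Qed.

End Endomorphisms.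

(** As [s] is multiplicative, it conjugates multiplication by [x] into multiplication by [s x]. The
    two determinants, the norms of [x] and [s x], therefore agree. *)
Lemma det_gal_quotient (K : fieldType) (E : splittingFieldType K) (n : nat)
    (e : n.-tuple E) (s : gal_of {:E}) (x : E) :
  basis_of fullv e -> x != 0 -> \det (endo_mx e (amull (s x / x))) = 1.
Proof.
move=> eB x0.
have sK : endo_mx e s *m endo_mx e (s^-1)%g = 1%:M.
  rewrite -endo_mx_comp // -(endo_mx1 eB); congr endo_mx; apply/lfunP => y.
  by rewrite comp_lfunE id_lfunE -galM ?memvf // mulgV gal_id.
have ds : \det (endo_mx e s) != 0.
  by apply/eqP => ds; move/eqP: (congr1 determinant sK); rewrite det_mulmx ds mul0r det1 eq_sym oner_eq0.
have conj : \det (endo_mx e (amull x)) = \det (endo_mx e (amull (s x))).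
  apply: (mulIf ds); rewrite [RHS]mulrC -!det_mulmx -!endo_mx_comp //.
  congr (\det (endo_mx e _)); apply/lfunP => y.
  by rewrite !comp_lfunE !lfunE /= rmorphM.
have dx : \det (endo_mx e (amull x)) != 0.
  apply/eqP => dx.
  have /(congr1 determinant)/eqP : endo_mx e (amull x) *m endo_mx e (amull x^-1) = 1%:M.
    rewrite -endo_mx_comp // -(endo_mx1 eB); congr endo_mx; apply/lfunP => y.
    by rewrite comp_lfunE id_lfunE !lfunE /= mulKf.
  by rewrite det_mulmx dx mul0r det1 eq_sym oner_eq0.
apply: (mulIf dx); rewrite mul1r {2}conj mulrC -det_mulmx -endo_mx_comp //.
congr (\det (endo_mx e _)); apply/lfunP => y.
by rewrite comp_lfunE !lfunE /= mulrA divfK.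
Qed.

(** * Galois action and approximation from [K] in a defectless extension *)

Section DefectlessGenerator.
Variables (K : fieldType) (Kbar : closedFieldType) (iota : {rmorphism K -> Kbar}).
Variables (G : oagType) (v : valuation Kbar G).
Variables (E : splittingFieldType K) (j : {rmorphism E -> Kbar}).
Hypothesis jK : forall c : K, j c%:A = iota c.

Let n := \dim {:E}.

Lemma valuation_independent_basis (B : 'I_n -> E) :
  (forall i, B i != 0) -> valuation_independent v j B -> basis_of fullv (mktuple B).
Proof.
move=> B0 Bindep; rewrite basisEfree size_tuple leqnn subvf !andbT.
apply/freeP => c c0 i; apply/eqP.
have := Bindep c i; rewrite (eq_bigr (fun i => c i *: (mktuple B)`_i)); last first.
  by move=> k _; rewrite -tnth_nth tnth_mktuple.
rewrite c0 rmorph0 vfun0 => /vle_infty_eq0/eqP.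
by rewrite fmorph_eq0 scaler_eq0 (negbTE (B0 i)) orbF.
Qed.

(** In the Leibniz expansion, independence applied to [x * B i] bounds the value of [x * B i] by
    that of [M i (s i) *: B (s i)]. In the product over [i] the factors [B] cancel because [s] is a
    permutation, so every term has value at least that of [x ^+ n]. *)
Lemma vle_det_mul (B : 'I_n -> E) x :
  (forall i, B i != 0) -> valuation_independent v j B ->
  vle (v (j x ^+ n)) (v (iota (\det (endo_mx (mktuple B) (amull x))))).
Proof.
move=> B0 Bindep; have eB := valuation_independent_basis B0 Bindep.
have eE (i : 'I_n) : (mktuple B)`_i = B i by rewrite -tnth_nth tnth_mktuple.
rewrite rmorph_sum; apply: vle_sum => s _.
set M := endo_mx _ _; have -> : v (iota ((-1) ^+ s * \prod_i M i (s i))) =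
    v (\prod_i iota (M i (s i))).
  by rewrite -rmorph_prod mulr_sign; case: ifP => // _; rewrite rmorphN vfunN.
have P0 : \prod_i j (B i) != 0 by apply/prodf_neq0 => i _; rewrite fmorph_eq0.
rewrite -(vle_mulr _ _ _ P0) {2}(reindex_inj (@perm_inj _ s)) /=.
rewrite -[X in _ ^+ X](card_ord n) -prodr_const -!big_split /=.
apply: vle_prod => i _; rewrite -(rmorph_scale jK) -rmorphM.
have := Bindep (M i) (s i).
suff -> : x * B i = \sum_k M i k *: B k by [].
have := endo_mxE eB (amull x) i; rewrite lfunE /= eE => ->.
by apply: eq_bigr => k _; rewrite eE.
Qed.

(* Multiplication by [y = (s x / x)^-1] has determinant 1, while in a valuation basis
   its determinant has value at least [n * v y]; hence [v y <= 0]. *)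
Lemma vle_gal_quotient (s : gal_of {:E}) x :
  defectless iota v j -> x != 0 -> vle (Some 0) (v (j (s x / x))).
Proof.
move=> /(defectless_valuation_basis jK)[B [B0 Bindep _]] x0.
pose s' : gal_of {:E} := (s^-1)%g; pose x' := s x.
have x'0 : x' != 0 by rewrite fmorph_eq0.
(* The inverse is again a quotient of the same shape, so its determinant is also 1. *)
have e : (s x / x)^-1 = s' x' / x'.
  by rewrite invf_div /x' /s' -galM ?memvf // mulgV gal_id.
have := vle_det_mul (s' x' / x') B0 Bindep.
rewrite det_gal_quotient ?valuation_independent_basis // rmorph1 -e vfun1.
rewrite fmorphV.
set y := j _; have y0 : y != 0 by rewrite fmorph_eq0 mulf_neq0 ?invr_eq0 ?fmorph_eq0.
rewrite -(vfun1 v) -(vle_mulr v _ _ (expf_neq0 n y0)) -exprMn mulVf // expr1n mul1r vfun1.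
exact/vle_exp0/adim_gt0.
Qed.

(** Take for [c] the coordinate of [x] along the basis vector 1. Then [x - c] is the sum of the
    remaining terms, and these also occur in [x - d], whose value is at most that of each of
    them. *)
Lemma defectless_vmax x : defectless iota v j ->
  exists c : K, forall d : K, vle (v (j x - iota d)) (v (j x - iota c)).
Proof.
move=> /(defectless_valuation_basis jK)[B [B0 Bindep [i0 Bi0]]].
have eB := valuation_independent_basis B0 Bindep.
pose a i := coord (mktuple B) i x.
have xE : x = \sum_i a i *: B i.
  rewrite {1}(coord_basis eB (memvf x)).
  by apply: eq_bigr => i _; rewrite -tnth_nth tnth_mktuple.
exists (a i0) => d.
have sub c : j x - iota c = j (\sum_i (if i == i0 then a i0 - c else a i) *: B i).
  rewrite -jK -rmorphB {1}xE; congr (j _).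
  rewrite (bigD1 i0) //= [RHS](bigD1 i0) //= eqxx Bi0 scalerBl addrAC; congr (_ + _).
  by apply: eq_bigr => i /negbTE ->.
rewrite [X in vle _ (v X)]sub rmorph_sum; apply: vle_sum => i _.
have [->|ii0] := eqVneq i i0; first by rewrite subrr scale0r rmorph0 vfun0 vle_infty.
have := Bindep (fun i => if i == i0 then a i0 - d else a i) i.
by rewrite -sub (negbTE ii0).
Qed.

Lemma generator_poly b x : <<1; b>>%VS = {:E}%VS ->
  exists2 q : {poly K}, x = (map_poly (in_alg E) q).[b] & (size q <= n)%N.
Proof.
move=> bE; have xb : x \in <<1; b>>%VS by rewrite bE memvf.
have [q qE] := polyOver1P (Fadjoin_polyOver 1 b x).
exists q; first by rewrite -qE Fadjoin_poly_eq.
rewrite -(size_map_poly (in_alg E)) -qE (leq_trans (size_Fadjoin_poly _ _ _)) //.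
by rewrite adjoin_degreeE bE dimv1 divn1.
Qed.

Lemma rmorph_horner_alg b q :
  j (map_poly (in_alg E) q).[b] = (map_poly iota q).[j b].
Proof.
rewrite -horner_map; congr (_.[_]); rewrite -map_poly_comp.
by apply: eq_map_poly => c; rewrite /= jK.
Qed.

(** The [d] elements [e k] span the image of [E] over [K]. A row vector killing the coordinate
    matrix of a basis of [E] would be a relation between the basis vectors, so this [n] by [d]
    matrix has rank [n]. *)
Lemma dim_generator_le b d : <<1; b>>%VS = {:E}%VS -> has_deg iota (j b) d ->
  (n <= d)%N.
Proof.
move=> bE [e [_ basis]].
have mem x : adjoin (range iota) (j b) (j x).
  by have [q -> _] := generator_poly x bE; rewrite rmorph_horner_alg; apply: adjoin_poly_value.
pose B := vbasis {:E}.
have /choice[c cP] (i : 'I_n) : exists c : 'I_d -> K, j B`_i = \sum_k iota (c k) * e k.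
  have [a [[ak ->] _]] := basis _ (mem B`_i).
  have /choice[c cP] k : exists c, a k = iota c by case: (ak k) => x _ <-; exists x.
  by exists c; apply: eq_bigr => k _; rewrite cP.
pose C := \matrix_(i < n, k < d) c i k.
suff : row_free C by move/eqP <-; apply: rank_leq_col.
rewrite -kermx_eq0; apply/eqP/matrixP => l i; rewrite [RHS]mxE.
have /freeP := basis_free (vbasisP {:E}); apply.
apply: (fmorph_inj j); rewrite rmorph0 rmorph_sum.
under eq_bigr => k _ do rewrite (rmorph_scale jK) cP mulr_sumr.
rewrite exchange_big big1 // => k _.
have /matrixP/(_ l k) := mulmx_ker C; rewrite !mxE => kC.
apply: etrans (_ : iota (\sum_m kermx C l m * C m k) * e k = 0); last first.
  by rewrite kC rmorph0 mul0r.
rewrite rmorph_sum mulr_suml; apply: eq_bigr => m _.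
by rewrite rmorphM [C _ _]mxE mulrA.
Qed.

(* The roots of [f] over [K] with [z = f b] and [deg f < n] have degree less than [n]. *)
Lemma vle_gal_generator b d (s : gal_of {:E}) z :
  <<1; b>>%VS = {:E}%VS -> has_deg iota (j b) d ->
  (forall z m, has_deg iota z m -> (m < d)%N -> vle (v (j b - z)) (v (j b))) ->
  b != 0 -> vle (Some 0) (v (j (s b / b - 1))) -> z != 0 ->
  vle (v (j (s b / b - 1))) (v (j (s z / z - 1))).
Proof.
move=> bE bd bmax b0 sb0 z0.
have [q zE qn] := generator_poly z bE.
have szE : s z = (map_poly (in_alg E) q).[s b].
  rewrite zE -horner_map; congr (_.[_]); rewrite -map_poly_comp.
  by apply: eq_map_poly => c /=; rewrite linearZ /= rmorph1.
have q0 : q != 0 by apply: contraNneq z0 => q0; rewrite zE q0 rmorph0 horner0.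
have [r rE] := closed_field_poly_normal (map_poly iota q).
have q_root w : w \in r -> root (map_poly iota q) w.
  by rewrite rE rootZ ?lead_coef_eq0 ?map_poly_eq0 // root_prod_XsubC.
have evalE x : (map_poly iota q).[x] = lead_coef (map_poly iota q) * \prod_(w <- r) (x - w).
  rewrite {1}rE hornerZ horner_prod; congr (_ * _).
  by apply: eq_bigr => w _; rewrite hornerXsubC.
have jz : j z = (map_poly iota q).[j b] by rewrite zE rmorph_horner_alg.
have jsz : j (s z) = (map_poly iota q).[j (s b)] by rewrite szE rmorph_horner_alg.
have lc0 : lead_coef (map_poly iota q) != 0 by rewrite lead_coef_eq0 map_poly_eq0.
(* The leading coefficients cancel, as [s z] and [z] are values of the same polynomial at [s b] and
   [b]. *)
have -> : j (s z / z - 1) = \prod_(w <- r) ((j (s b) - w) / (j b - w)) - 1.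
  rewrite rmorphB rmorph1 fmorph_div jz jsz !evalE; congr (_ - 1).
  by rewrite -mulf_div divff // mul1r prodf_div.
rewrite rmorphB rmorph1 fmorph_div; apply: vle_prod_sub1.
- by rewrite fmorph_eq0.
- by rewrite rmorphB rmorph1 fmorph_div in sb0.
(* The degree [m] of the root satisfies [m < size q <= n <= d]. *)
- move=> w /q_root wr; have [m wm mq] := has_deg_root q0 wr.
  by apply: bmax wm _; rewrite (leq_trans mq) // (leq_trans qn) // (dim_generator_le bE).
- move=> w /q_root; apply: contraTneq => <-.
  by rewrite rootE -jz fmorph_eq0.
Qed.

End DefectlessGenerator.

(** * Purity in terms of approximation by elements of smaller degree *)

Section Purity.
Variables (K : fieldType) (Kbar : closedFieldType) (iota : {rmorphism K -> Kbar}).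
Variables (G : oagType) (v : valuation Kbar G).

(** In an Okutsu sequence of length 1 the elements of [A 1] have degree 1, hence lie in [K], and
    (OS2) says that they approximate [a] as well as any element of smaller degree. *)
Lemma pure_vle a : pure iota v a ->
  exists d, [/\ ~ range iota a, has_deg iota a d, (1 < d)%N &
    forall z m, has_deg iota z m -> (m < d)%N ->
      exists c : K, vle (v (a - z)) (v (a - iota c))].
Proof.
case=> A [d [aK _ Adeg [da dlt d1] OS2 _ _ _]]; exists (d 0%N); split=> //.
  by rewrite -d1; apply: dlt.
move=> z m zm md; have [z' Az' h] := OS2 0%N z m isT zm md.
have := Adeg 1%N z' isT Az'; rewrite d1 => /has_deg1_range[c _ cz].
by exists c; rewrite cz.
Qed.

(** The sets [{a}] and [{0}] form an Okutsu sequence: 0 has degree 1 and is a best approximation of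
    [a]. The maximum exists, so (OS5) is vacuous. *)
Lemma pure_of_vle a d : ~ range iota a -> has_deg iota a d -> (1 < d)%N ->
  (forall z m, has_deg iota z m -> (m < d)%N -> vle (v (a - z)) (v a)) ->
  pure iota v a.
Proof.
move=> aK ad d1 amax.
have deg0 : has_deg iota 0 1 by apply: range_has_deg1; exists 0; rewrite ?rmorph0.
have max_eq : is_vmax (dist_deg_eq iota v a 1) (v a).
  split=> [|_ [z /= z1 <-]]; first by exists 0 => //; rewrite sub0r vfunN.
  by rewrite -vfunN opprB; apply: amax z1 d1.
have max_lt : is_vmax (dist_deg_lt iota v a d) (v a).
  split=> [|_ [z /= [m zm md] <-]]; last exact: amax zm md.
  by exists 0; rewrite ?subr0 //; exists 1%N.
exists (fun i => if i is 0 then [set a]%classic else [set 0]%classic).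
exists (fun i => if i is 0 then d else 1%N); split=> //.
- by case=> [|i] z _ ->.
- by split=> //; case.
- by case=> // z m _ zm md; exists 0 => //; rewrite subr0; apply: amax zm md.
- case=> // z z' _ -> ->; rewrite subrr subr0 vfun0 /vlt; apply/negP => /vle_infty_eq0 a0.
  by apply: aK; exists 0; rewrite ?rmorph0.
- case=> // _; split; first by split=> _; [exists (v a)|exists 0].
  by move=> z zE; have -> : z = 0; [have : [set z]%classic z by []; rewrite -zE|rewrite subr0].
- by case=> // _ []; exists (v a).
Qed.

End Purity.

(** * Comparison of the two ideals *)

Lemma ideal_gen_sub (F : fieldType) (O S S' : set F) :
  (forall x, S x -> exists c y, [/\ O c, S' y & x = c * y]) ->
  (ideal_gen O S `<=` ideal_gen O S')%classic.
Proof.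
move=> h x Sx I [idI S'I]; apply: Sx; split=> // y /h[c [z [Oc S'z ->]]].
by case: idI => _ _ _; apply=> //; apply: S'I.
Qed.

Theorem lemma8p8
  (K : fieldType) (Kbar : closedFieldType) (iota : {rmorphism K -> Kbar})
  (Kbar_alg : forall x : Kbar, algebraicOver iota x)
  (G : oagType) (v : valuation Kbar G)
  (v_hens : henselian iota v)
  (v_nontriv : nontrivially_valued iota v)
  (E : splittingFieldType K) (j : {rmorphism E -> Kbar})
  (jK : forall c : K, j c%:A = iota c)
  (b' : E) (E_gen : <<1; b'>>%VS = {:E}%VS)
  (E_galois : galois 1 {:E})
  (E_defectless : defectless iota v j)
  (b'_pure : pure iota v (j b')) :
  exists b : E,
    [/\ <<1; b>>%VS = {:E}%VS,
        pure iota v (j b)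
      & forall H : {group gal_of {:E}},
          H \subset 'Gal({:E} / 1)%g -> H :!=: 1%g ->
          ramification_ideal v j H = ideal_of_generator v j b H].
Proof.
have [d [b'K b'd d1 b'_near]] := pure_vle b'_pure.
have [c cmax] := defectless_vmax jK b' E_defectless.
pose b := b' - c%:A.
have jb : j b = j b' - iota c by rewrite rmorphB jK.
have bE : <<1; b>>%VS = {:E}%VS.
  apply/eqP; rewrite eqEsubv subvf -E_gen; apply/FadjoinP; split; first exact: subv_adjoin.
  rewrite -(subrK c%:A b'); apply: rpredD; first exact: memv_adjoin.
  by apply: (subvP (subv_adjoin _ _)); apply: rpredZ; apply: mem1v.
have bd : has_deg iota (j b) d by rewrite jb -rmorphN; apply/has_degD.
have bK : ~ range iota (j b).
  case=> x _ xb; apply: b'K; exists (x + c) => //.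
  by rewrite rmorphD xb jb subrK.
have bmax z m : has_deg iota z m -> (m < d)%N -> vle (v (j b - z)) (v (j b)).
  (* Adding an element of [K] preserves the degree, and [b - z = b' - (z + c)]. Purity of [b']
     replaces [z + c] by some [c'] in [K], and [c] is at least as good as [c']. *)
  move=> zm md; have [c' h] := b'_near (z + iota c) m ((has_degD _ _ _ _).2 zm) md.
  rewrite jb -addrA -opprD [iota c + z]addrC.
  exact: vle_trans h (cmax c').
have b0 : b != 0.
  by apply/eqP => b0; apply: bK; exists 0; rewrite ?rmorph0 ?b0 ?rmorph0.
exists b; split=> //; first exact: pure_of_vle bK bd d1 bmax.
move=> H _ _.
have v1 : vle (Some 0) (v (j 1)) by rewrite rmorph1 vfun1 vle_refl.
have sb_ge0 (s : gal_of {:E}) : vle (Some 0) (v (j (s b / b - 1))).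
  by rewrite rmorphB; apply: vle_sub => //; apply: (vle_gal_quotient jK _ E_defectless).
apply/seteqP; split; apply: ideal_gen_sub => y [s sH].
  case=> z z0 ->.
  have le := vle_gal_generator jK bE bd bmax b0 (sb_ge0 s) z0.
  (* If [s] fixes [b], the inequality [le] forces [s z / z - 1] to have value infinity, so it is 0.
     Otherwise the quotient of the two elements is integral. *)
  have [e|nz] := eqVneq (s b / b - 1) 0.
    exists 1, (s b / b - 1); split=> //; first by exists s.
    rewrite mul1r e; apply/eqP; rewrite -(fmorph_eq0 j); apply/eqP.
    by apply: (@vle_infty_eq0 _ _ v); rewrite e rmorph0 vfun0 in le.
  exists ((s z / z - 1) / (s b / b - 1)), (s b / b - 1); split; last by rewrite divfK.
    have jnz : j (s b / b - 1) != 0 by rewrite fmorph_eq0.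
    rewrite -[Oring _ _ _]/(is_true (vle (Some 0) (v (j _)))) -(vfun1 v).
    by rewrite -(vle_mulr _ _ _ jnz) mul1r -rmorphM divfK.
  by exists s.
(* For the other inclusion, [z = b] gives the generators. *)
move=> ->; exists 1, (s b / b - 1); split; rewrite ?mul1r //.
by exists s => //; exists b.
Qed.
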